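(* Let $\Omega\subset\mathbb{R}^n$ be a bounded domain, $2\le n<p\le\infty$, $f\in\mathcal{C}(\Omega)$, and let $u\in\mathcal{C}(\overline\Omega)$ be a viscosity solution of $-\Delta_p^N u=f$ in $\Omega$. Then for any $x\in\Omega$, $$\frac{|u(y)-u(x)|}{|y-x|^{1-\alpha_p}}\le\sup_{z\in\partial\Omega}\frac{|u(z)-u(x)|}{|z-x|^{1-\alpha_p}}+\frac{C_p}{1-\alpha_p}\,{\rm diam}(\Omega)^{1+\alpha_p}\,\|f\|_{L^\infty(\Omega)}$$ for every $y\in\overline\Omega$, $y\ne x$, where $\alpha_p=\frac{n-1}{p-1}$ and $C_p=\frac{p}{p+n-2}$ for $n<p<\infty$, and $\alpha_\infty=0$, $C_\infty=1$.
   Context: For a symmetric matrix $X$, $M(X)$ and $m(X)$ are its greatest and smallest eigenvalues. Where $\nabla\varphi\ne0$: $\Delta_\infty^N\varphi=\big\langle D^2\varphi\frac{\nabla\varphi}{|\nabla\varphi|},\frac{\nabla\varphi}{|\nabla\varphi|}\big\rangle$ and, for $p<\infty$, $\Delta_p^N\varphi=\frac1p|\nabla\varphi|^{2-p}{\rm div}(|\nabla\varphi|^{p-2}\nabla\varphi)=\frac1p\Delta\varphi+\frac{p-2}{p}\Delta_\infty^N\varphi$. Viscosity solutions (for $2<p\le\infty$): a continuous $u$ is a viscosity solution of $-\Delta_p^N u=f$ in $\Omega$ if it is a sub- and a supersolution, i.e. for all $x_0\in\Omega$ and $\varphi\in\mathcal{C}^2(\Omega)$: (sub) if $u-\varphi$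 has a local maximum at $x_0$, then $-\Delta_p^N\varphi(x_0)\le f(x_0)$ if $\nabla\varphi(x_0)\ne0$, while if $\nabla\varphi(x_0)=0$ then $-\frac1p\Delta\varphi(x_0)-\frac{p-2}pM(D^2\varphi(x_0))\le f(x_0)$ when $p<\infty$, and $-M(D^2\varphi(x_0))\le f(x_0)$ when $p=\infty$; (super) if $u-\varphi$ has a local minimum at $x_0$, then $-\Delta_p^N\varphi(x_0)\ge f(x_0)$ if $\nabla\varphi(x_0)\ne0$, while if $\nabla\varphi(x_0)=0$ then $-\frac1p\Delta\varphi(x_0)-\frac{p-2}pm(D^2\varphi(x_0))\ge f(x_0)$ when $p<\infty$, and $-m(D^2\varphi(x_0))\ge f(x_0)$ when $p=\infty$. If $f$ is unbounded, $\|f\|_{L^\infty(\Omega)}=+\infty$ and the estimate is trivial. *)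

(* Defs.v *)
From HB Require Import structures.
From mathcomp Require Export all_boot all_order all_algebra.
From mathcomp Require Export all_classical all_reals all_analysis.

Set Implicit Arguments.
Unset Strict Implicit.
Unset Printing Implicit Defensive.

Export Order.TTheory GRing.Theory Num.Theory.
Export numFieldNormedType.Exports.

Local Open Scope classical_set_scope.
Local Open Scope ring_scope.

(* R^n is 'rV[R]_n.  The norm `|x| that the library puts on it is the max
   norm: it gives the right topology and bounded sets, but lengths have to be
   measured with the Euclidean norm enorm. *)

Section Euclidean.
Variables (R : realType) (n : nat).
Implicit Types (v w x : 'rV[R]_n) (A : set 'rV[R]_n).

Definition dotv v w : R := \sum_(i < n) v 0 i * w 0 i.

Definition enorm v : R := Num.sqrt (dotv v v).

Definition ediam A : R := sup [set enorm (x - y) | x in A & y in A].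

Definition boundary A : set 'rV[R]_n := closure A `\` A^°.

Definition bounded_domain A : Prop :=
  [/\ open A, connected A, A !=set0 & bounded_set A].

(* Lebesgue-null: coverable by countably many boxes of arbitrarily small total
   volume. *)
Definition lebesgue_null A : Prop :=
  forall e : R, 0 < e ->
  exists a b : nat -> 'rV[R]_n,
    [/\ forall k i, a k 0 i <= b k 0 i,
        A `<=` \bigcup_k [set x | forall i, a k 0 i <= x 0 i <= b k 0 i] &
        (\sum_(0 <= k <oo) (\prod_(i < n) (b k 0 i - a k 0 i))%:E <= e%:E)%E].

(* Essential supremum of |f| over A for the Lebesgue measure (the library has
   no Lebesgue measure on 'rV[R]_n); it may be +oo. *)
Definition Linfty_norm A (f : 'rV[R]_n -> R) : \bar R :=
  ereal_inf [set M : \bar R |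
    (0 <= M)%E /\ lebesgue_null [set x | A x /\ (M < `|f x|%:E)%E]].

End Euclidean.

Section Calculus.
Variables (R : realType) (n : nat).
Implicit Types (phi : 'rV[R]_n -> R) (x : 'rV[R]_n).

Definition partial (i : 'I_n) phi x : R := 'D_(delta_mx 0 i) phi x.

Definition grad phi x : 'rV[R]_n := \row_i partial i phi x.

Definition hess phi x : 'M[R]_n :=
  \matrix_(i, j) partial j (partial i phi) x.

Definition divergence (V : 'rV[R]_n -> 'rV[R]_n) x : R :=
  \sum_(i < n) partial i (fun y => V y 0 i) x.

Definition laplacian phi x : R := \tr (hess phi x).

Definition C2 (Omega : set 'rV[R]_n) phi : Prop :=
  forall x, Omega x ->
  [/\ {for x, continuous phi},
      forall i, derivable phi x (delta_mx 0 i) /\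
                {for x, continuous (partial i phi)} &
      forall i j, derivable (partial i phi) x (delta_mx 0 j) /\
                  {for x, continuous (partial j (partial i phi))}].

(* The set of eigenvalues of a symmetric matrix of positive size is finite and
   nonempty, so these are a maximum and a minimum. *)
Definition max_eig (X : 'M[R]_n) : R := sup [set a : R | eigenvalue X a].
Definition min_eig (X : 'M[R]_n) : R := inf [set a : R | eigenvalue X a].

End Calculus.

Section PLaplacian.
Variables (R : realType) (n : nat).
Implicit Types (phi f u : 'rV[R]_n -> R) (x : 'rV[R]_n) (Omega : set 'rV[R]_n).

(* The exponent p ranges over \bar R; only p > n is ever used, so that the
   catch-all branches below are the case p = +oo. *)

(* Both operators are meaningful only where grad phi x != 0. *)
Definition inf_nlap phi x : R :=
  let v := (enorm (grad phi x))^-1 *: grad phi x in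
  dotv (v *m (hess phi x)^T) v.

Definition nlap (p : \bar R) phi x : R :=
  if p is q%:E then
    q^-1 * enorm (grad phi x) `^ (2 - q) *
    divergence (fun y => enorm (grad phi y) `^ (q - 2) *: grad phi y) x
  else inf_nlap phi x.

(* Substitutes for nlap p phi x in the sub- (resp. super-) solution condition
   when grad phi x = 0. *)
Definition nlap0_sub (p : \bar R) phi x : R :=
  if p is q%:E then
    q^-1 * laplacian phi x + (q - 2) / q * max_eig (hess phi x)
  else max_eig (hess phi x).

Definition nlap0_super (p : \bar R) phi x : R :=
  if p is q%:E then
    q^-1 * laplacian phi x + (q - 2) / q * min_eig (hess phi x)
  else min_eig (hess phi x).

Definition visc_sub (p : \bar R) Omega f u : Prop :=
  forall x0 phi, Omega x0 -> C2 Omega phi ->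
  (\forall x \near x0, u x - phi x <= u x0 - phi x0) ->
  (grad phi x0 != 0 -> - nlap p phi x0 <= f x0) /\
  (grad phi x0 = 0 -> - nlap0_sub p phi x0 <= f x0).

Definition visc_super (p : \bar R) Omega f u : Prop :=
  forall x0 phi, Omega x0 -> C2 Omega phi ->
  (\forall x \near x0, u x0 - phi x0 <= u x - phi x) ->
  (grad phi x0 != 0 -> f x0 <= - nlap p phi x0) /\
  (grad phi x0 = 0 -> f x0 <= - nlap0_super p phi x0).

Definition visc_solution (p : \bar R) Omega f u : Prop :=
  [/\ {within Omega, continuous u},
      visc_sub p Omega f u & visc_super p Omega f u].

End PLaplacian.

Section Constants.
Variables (R : realType) (n : nat).

Definition alpha_ (p : \bar R) : R :=
  if p is q%:E then (n%:R - 1) / (q - 1) else 0.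

Definition C_ (p : \bar R) : R :=
  if p is q%:E then q / (q + n%:R - 2) else 1.

End Constants.

(* Main.v *)
Require Import Defs.
From mathcomp Require Import measurable_realfun lra ring.

(* Put r = |y - x|.  The function w(y) = u(x) + A r^(1 - alpha) - B r^2 has
   -Delta_p^N w = 2 B / C_p, since r^(1 - alpha) is p-harmonic away from x, and
   its gradient does not vanish on Omega once A is large enough.  Choosing
   2 B / C_p > sup f and A so large that w >= u on the boundary, u - w cannot
   have a positive maximum at a point y0 of Omega: y0 is not x, where u = w, and
   the subsolution condition would fail at y0.  Since w is not smooth at x, the
   test function used at y0 is a quadratic polynomial in r^2 that touches w from
   above and is therefore C^2 on all of Omega.  The reverse bound is the same
   argument for -u, and L^infinity bounds of the continuous f hold everywhere
   because a nonempty open set is not null. *)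

Local Open Scope classical_set_scope.
Local Open Scope ring_scope.

Set Implicit Arguments.
Unset Strict Implicit.
Unset Printing Implicit Defensive.

(** * Null sets and the essential supremum *)

Lemma integral_scaled_indic_itv (R : realType) (k a b : R) : 0 <= k -> a <= b ->
  (\int[lebesgue_measure]_t (k * \1_(`[a, b] : set R) t)%:E = (k * (b - a))%:E)%E.
Proof.
move=> k0 ab; under eq_integral do rewrite EFinM.
rewrite ge0_integralZl//; last first.
  by apply/measurable_EFinP; exact: measurable_indic.
rewrite integral_indic// setIT/= lebesgue_measure_itv/= lte_fin EFinM.
have [_|ba] := ltP a b; first by rewrite EFinB.
by rewrite (_ : b = a) ?subrr//; apply/eqP; rewrite eq_le ba ab.
Qed.

(* Integrating out the last coordinate turns a domination of indicators of
   boxes with weights [c] into one in dimension [n] with weights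
   [c * (b n - a n)]. *)
Lemma box_volume_subadditive (R : realType) (n : nat) (a b : nat -> R)
    (A B : nat -> nat -> R) (c : R) (d : nat -> R) :
  (forall i, (i < n)%N -> a i <= b i) ->
  (forall k i, (i < n)%N -> A k i <= B k i) ->
  0 <= c -> (forall k, 0 <= d k) ->
  (forall x : nat -> R,
    (c * \prod_(i < n) \1_(`[a i, b i] : set R) (x i))%:E <=
    \sum_(0 <= k <oo) (d k * \prod_(i < n) \1_(`[A k i, B k i] : set R) (x i))%:E)%E ->
  ((c * \prod_(i < n) (b i - a i))%:E <=
    \sum_(0 <= k <oo) (d k * \prod_(i < n) (B k i - A k i))%:E)%E.
Proof.
elim: n c d => [|n IH] c d ab AB c0 d0 H.
  have := H (fun=> 0); rewrite !big_ord0.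
  under eq_eseriesr do rewrite big_ord0.
  by under [in X in _ -> X]eq_eseriesr do rewrite big_ord0.
have ind0 (S : set R) t : 0 <= \1_S t :> R by rewrite indicE; case: (_ \in _).
rewrite big_ord_recr/= (mulrC (\prod_(i < n) _)) mulrA.
under eq_eseriesr do rewrite big_ord_recr/= (mulrC (\prod_(i < n) _)) mulrA.
apply: (IH (c * _) (fun k => d k * _)) => [i lin|k i lin|||x].
- by apply: ab; rewrite ltnS ltnW.
- by apply: AB; rewrite ltnS ltnW.
- by rewrite mulr_ge0// subr_ge0 ab.
- by move=> k; rewrite mulr_ge0// subr_ge0 AB.
(* [y t] puts [t] in the last coordinate and keeps [x] in the others, so that [H (y t)] can be
   integrated in [t] with [x] fixed; nonnegativity allows series and integral to be exchanged. *)
pose y t i : R := if i == n then t else x i.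
have prodE (lo hi : nat -> R) t : \prod_(i < n.+1) \1_(`[lo i, hi i] : set R) (y t i) =
    \prod_(i < n) \1_(`[lo i, hi i] : set R) (x i) * \1_(`[lo n, hi n] : set R) t :> R.
  rewrite big_ord_recr/= /y eqxx; congr (_ * _); apply: eq_bigr => i _.
  by rewrite ltn_eqF.
have prod0 (lo hi : nat -> R) : 0 <= \prod_(i < n) \1_(`[lo i, hi i] : set R) (x i) :> R.
  by apply: prodr_ge0.
have meas (k lo hi : R) : measurable_fun setT (fun t => (k * \1_(`[lo, hi] : set R) t)%:E).
  apply/measurable_EFinP; apply: measurable_funM => //; exact: measurable_indic.
rewrite mulrAC -integral_scaled_indic_itv ?mulr_ge0 ?ab//.
under eq_eseriesr do rewrite mulrAC -integral_scaled_indic_itv ?mulr_ge0 ?AB//.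
rewrite -integral_nneseries//; last 2 first.
- by move=> k; exact: meas.
- by move=> k t _; rewrite lee_fin !mulr_ge0.
apply: ge0_le_integral => //.
- by move=> t _; rewrite lee_fin !mulr_ge0.
- exact: meas.
- apply: (ge0_emeasurable_sum (P := xpredT)) => [k t _ _|k _]; last exact: meas.
  by rewrite lee_fin !mulr_ge0.
- move=> t _; have := H (y t); rewrite prodE mulrA.
  by under eq_eseriesr do rewrite prodE mulrA.
Qed.

(** The induction on dimension uses coordinates indexed by [nat], so rows are extended by zero. *)
Definition row_coord (R : realType) (n : nat) (v : 'rV[R]_n) (i : nat) : R :=
  if insub i is Some j then v 0 j else 0.

Lemma row_coordE (R : realType) (n : nat) (v : 'rV[R]_n) (i : 'I_n) :
  row_coord v i = v 0 i.
Proof. by rewrite /row_coord valK. Qed.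

(** A cube of side [e] inside [A] cannot be covered by boxes of total volume [e ^+ n / 2]: this is
    [box_volume_subadditive] with all weights equal to 1. *)
Lemma open_not_lebesgue_null (R : realType) (n : nat) (A : set 'rV[R]_n) :
  open A -> A !=set0 -> ~ lebesgue_null A.
Proof.
move=> oA [x Ax] nullA.
have /nbhs_ballP[e /= e0 eA] : nbhs x A by exact: open_nbhs_nbhs.
have e20 : 0 < e / 2 by rewrite divr_gt0.
have vol0 : 0 < e ^+ n by rewrite exprn_gt0.
have [a [b [ab Acov vol]]] := nullA (e ^+ n / 2) (divr_gt0 vol0 (ltr0n _ 2)).
pose xc := row_coord x.
have := @box_volume_subadditive R n (fun i => xc i - e / 2) (fun i => xc i + e / 2)
  (fun k => row_coord (a k)) (fun k => row_coord (b k)) 1 (fun=> 1).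
have -> : \prod_(i < n) (xc i + e / 2 - (xc i - e / 2)) = e ^+ n.
  rewrite (eq_bigr (fun=> e)) ?big_const_ord ?iter_mulr_1// => i _.
  by rewrite opprB addrC addrA subrK -splitr.
under eq_eseriesr => k _.
  rewrite mul1r; under eq_bigr do rewrite !row_coordE.
  over.
move=> H; suff : ((1 * e ^+ n)%:E <= (e ^+ n / 2)%:E :> \bar R)%E.
  by rewrite lee_fin mul1r leNgt ltr_pdivrMr// ltr_pMr// ltr1n.
apply: le_trans vol; apply: H => // [i _|k i lin|y].
- by rewrite lerD2l (le_trans _ (ltW e20))// oppr_le0 ltW.
- by rewrite (row_coordE _ (Ordinal lin)) (row_coordE _ (Ordinal lin)).
have term0 (lo hi : nat -> R) :
    0 <= \prod_(i < n) \1_(`[lo i, hi i] : set R) (y i) :> R.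
  by apply: prodr_ge0 => i _; rewrite indicE; case: (_ \in _).
(* Outside the cube the left side is zero. Inside it, the point lies in [A], because the ball of the
   max norm is itself a cube, and some box of the cover contributes 1. *)
have [yx|] := pselect (forall i : 'I_n, xc i - e / 2 <= y i <= xc i + e / 2); last first.
  move=> /existsNP[i yi]; rewrite (bigD1 i)//= indicE memNset ?mul0r ?mulr0; last first.
    by rewrite /= in_itv.
  by apply: nneseries_ge0 => k _ _; rewrite lee_fin mul1r.
have Ay : A (\row_(i < n) y i).
  apply: eA.
  split => // i j; rewrite ord1 mxE /ball/= ltr_distlC.
  have := yx j; rewrite /xc row_coordE; lra.
have [k _ yk] := Acov _ Ay.
apply: (@le_trans _ _ 1%:E).
  rewrite lee_fin mul1r; apply: prodr_ile1 => i _.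
  by rewrite indicE; case: (_ \in _); rewrite ?lexx ?ler01.
(* The partial sum with [k.+1] terms is the first one that contains the term of index [k]. *)
apply: le_trans (nneseries_lim_ge k.+1 _); last by move=> j _ _; rewrite lee_fin mul1r.
rewrite big_nat_recr//= -[X in (X <= _)%E]add0e; apply: leeD.
  by apply: sume_ge0 => j _; rewrite lee_fin mul1r.
rewrite lee_fin mul1r big1// => i _; rewrite indicE mem_set//= in_itv/= !row_coordE.
by have := yk i; rewrite mxE.
Qed.

(** If M < |f x|, then by continuity the points of [A] where |f| exceeds M form a nonempty open set,
    which is not null; such an M does not enter the infimum. *)
Lemma Linfty_norm_ge (R : realType) (n : nat) (A : set 'rV[R]_n)
    (f : 'rV[R]_n -> R) x :
  open A -> {within A, continuous f} -> A x -> (`|f x|%:E <= Linfty_norm A f)%E.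
Proof.
move=> oA; rewrite continuous_open_subspace// => cf Ax.
apply: le_ereal_inf_tmp => M [M0 nullM]; rewrite leNgt; apply/negP => Mfx.
apply: open_not_lebesgue_null nullM; last by exists x.
rewrite openE => y [Ay My].
have Mfin : M \is a fin_num.
  by apply/fin_real; rewrite (lt_le_trans _ M0)// (lt_trans Mfx)// ltry.
have fM : fine M < `|f y| by rewrite -lte_fin fineK.
rewrite /interior; near=> z; split; first by near: z; exact: open_nbhs_nbhs.
rewrite -(fineK Mfin) lte_fin; near: z.
have cn : {for y, continuous (fun z => `|f z|)}.
  have cfy : {for y, continuous f} by apply: cf; rewrite inE.
  exact: (continuous_comp cfy (@norm_continuous _ _ _)).
exact: cvgr_gt cn _ fM.
Unshelve. all: by end_near. Qed.

(** * Radial functions *)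

(** Reduces partial derivatives to one variable, where |y - x|^2 becomes a quadratic polynomial in
    the step [h]. *)
Lemma is_derive_line (R : realType) (V W : normedModType R) (f : V -> W) (x v : V) (df : W) :
  is_derive (0 : R) 1 (fun h : R => f (h *: v + x)) df -> is_derive x v f df.
Proof.
have E : (fun h : R => h^-1 *: (((fun h : R => f (h *: v + x)) \o shift 0) (h *: 1) -
       (fun h : R => f (h *: v + x)) 0))
   = (fun h : R => h^-1 *: ((f \o shift x) (h *: v) - f x)).
  by apply/funext => h /=; rewrite addr0 scale0r add0r /GRing.scale/= mulr1.
move=> [dv dE]; split; first by move: dv; rewrite /derivable E.
by move: dE; rewrite /derive E.
Qed.

Section Radial.
Variables (R : realType) (n : nat) (x : 'rV[R]_n).
Implicit Types (y : 'rV[R]_n) (K P : R -> R).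

Definition sqdist y : R := dotv (y - x) (y - x).

Lemma sqdist_delta y (i : 'I_n) (h : R) :
  sqdist (h *: delta_mx 0 i + y) = sqdist y + (2 * (y 0 i - x 0 i)) * h + h ^+ 2.
Proof.
rewrite /sqdist /dotv !(bigD1 i (P := xpredT))//= !mxE !eqxx/= mulr1.
rewrite (eq_bigr (fun j => (y - x) 0 j * (y - x) 0 j)); first by ring.
by move=> j /negPf ji; rewrite !mxE ji andbF mulr0 add0r.
Qed.

Lemma is_derive_quad0 (a b : R) : is_derive (0 : R) 1 (fun h => a + b * h + h ^+ 2) b.
Proof.
apply: is_derive_eq.
rewrite /GRing.scale/=; ring.
Qed.

Lemma is_derive_sqdist_comp K (dK : R) y (i : 'I_n) :
  is_derive (sqdist y) 1 K dK ->
  is_derive y (delta_mx 0 i) (fun y => K (sqdist y)) (dK * (2 * (y 0 i - x 0 i))).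
Proof.
move=> dKy; apply: is_derive_line.
rewrite (_ : (fun h => _) =
  K \o (fun h => sqdist y + (2 * (y 0 i - x 0 i)) * h + h ^+ 2)); last first.
  by apply/funext => h /=; rewrite sqdist_delta.
apply: is_derive1_comp; last exact: is_derive_quad0.
by rewrite mulr0 expr0n/= !addr0.
Qed.

Lemma is_derive_coord y (i j : 'I_n) :
  is_derive y (delta_mx 0 j) (fun y => y 0 i - x 0 i) ((i == j)%:R : R).
Proof.
apply: is_derive_line.
rewrite (_ : (fun h => _) = (fun h : R => (i == j)%:R * h + (y 0 i - x 0 i))); last first.
  by apply/funext => h /=; rewrite !mxE eqxx/= mulrC; ring.
apply: is_derive_eq.
rewrite /GRing.scale/=; ring.
Qed.

(** Used twice: for the Hessian, the gradient of a radial function being such a field, and for the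
    flux whose divergence defines the p-Laplacian. *)
Lemma is_derive_radial_field K (dK : R) y (i j : 'I_n) :
  is_derive (sqdist y) 1 K dK ->
  is_derive y (delta_mx 0 j) (fun y => K (sqdist y) * (y 0 i - x 0 i))
    (K (sqdist y) * (i == j)%:R + 2 * dK * (y 0 i - x 0 i) * (y 0 j - x 0 j)).
Proof.
move=> dKy.
have := is_deriveM (is_derive_sqdist_comp j dKy) (is_derive_coord y i j).
move/is_derive_eq; apply.
rewrite /GRing.scale/=; ring.
Qed.

Lemma continuous_sqdist : continuous sqdist.
Proof.
apply: continuous_big => [|i _ y]; first exact: add_continuous.
have c : {for y, continuous (fun y : 'rV[R]_n => (y - x) 0 i)}.
  rewrite (_ : (fun y : 'rV[R]_n => _) = (fun y => y 0 i - x 0 i)); last first.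
    by apply/funext => z; rewrite !mxE.
  apply: (@continuousB _ _ _ (fun y : 'rV[R]_n => y 0 i) (cst (x 0 i))).
    exact: coord_continuous.
  exact: cst_continuous.
exact: (continuousM c c).
Qed.

End Radial.

(** Near [s0] the difference quotients of [g] stay below [k + e], so the derivative of the right
    side minus [f] has the sign of [s - s0]; the mean value theorem concludes. *)
Lemma taylor2_upper (R : realType) (f g : R -> R) (s0 k e : R) :
  (\forall s \near s0, is_derive (s : R) 1 f (g s)) -> is_derive s0 1 g k -> 0 < e ->
  \forall s \near s0, f s <= f s0 + g s0 * (s - s0) + (k + e) / 2 * (s - s0) ^+ 2.
Proof.
move=> fg [dg gE] e0.
have : \forall h \near 0^', h^-1 *: (g (h *: 1 + s0) - g s0) < k + e.
  have := dg; rewrite /derivable => /cvg_ex[l /= gl].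
  have lk : l = k by rewrite -gE; apply/esym/cvg_lim.
  by apply: (cvgr_lt _ gl); rewrite lk ltrDl.
move=> /nbhs_ballP[d /= d0 gd].
have /nbhs_ballP[d' /= d'0 fd] := fg.
have r0 : 0 < Order.min d d' by rewrite lt_min d0.
have slope t : `|s0 - t| < d -> t != s0 -> (t - s0)^-1 * (g t - g s0) < k + e.
  move=> ts0 tn; have := gd (t - s0); rewrite /ball/= sub0r normrN distrC => /(_ ts0).
  rewrite subr_eq0 => /(_ tn).
  by rewrite [(t - s0) *: _](mulr1 (t - s0)) subrK.
pose D s := f s0 + g s0 * (s - s0) + (k + e) / 2 * (s - s0) ^+ 2 - f s.
pose dD s := g s0 + (k + e) * (s - s0) - g s.
have derD s : `|s0 - s| < d' -> is_derive s 1 D (dD s).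
  move=> /fd dfs; rewrite /D; apply: is_derive_eq.
  by rewrite /dD /GRing.scale/=; field.
have D0 : D s0 = 0 by rewrite /D; ring.
apply/nbhs_ballP; exists (Order.min d d') => //= s; rewrite /ball/= lt_min => /andP[sd sd'].
suff : 0 <= D s by rewrite /D subr_ge0.
have contD a b : (forall z, z \in `[a, b] -> `|s0 - z| < d') ->
    {within `[a, b], continuous D}.
  move=> H; apply: derivable_within_continuous => z zab.
  by have := derD z (H z zab).
have [ss0|s0s|->] := ltgtP s s0; last by rewrite D0.
- have far z : z \in `[s, s0] -> `|s0 - z| < d'.
    by rewrite in_itv/= => /andP[? ?]; rewrite (le_lt_trans _ sd')// !ger0_norm; lra.
  have [|c cin] := @MVT _ D dD s s0 ss0 _ (contD _ _ far).
    by move=> z zin; apply: derD; apply: far; exact: subset_itv_oo_cc zin.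
  move: cin; rewrite in_itv/= => /andP[sc cs0]; rewrite D0 sub0r => DE.
  have cd : `|s0 - c| < d by rewrite (le_lt_trans _ sd)// !ger0_norm; lra.
  have := slope c cd; rewrite lt_eqF// => /(_ isT).
  rewrite mulrC ltr_ndivrMr ?subr_lt0// => gc.
  rewrite -oppr_le0 DE; apply: mulr_le0_ge0; last by rewrite subr_ge0 ltW.
  by rewrite /dD; lra.
- have far z : z \in `[s0, s] -> `|s0 - z| < d'.
    by rewrite in_itv/= => /andP[? ?]; rewrite (le_lt_trans _ sd')// !ler0_norm; lra.
  have [|c cin] := @MVT _ D dD s0 s s0s _ (contD _ _ far).
    by move=> z zin; apply: derD; apply: far; exact: subset_itv_oo_cc zin.
  move: cin; rewrite in_itv/= => /andP[sc cs0]; rewrite D0 subr0 => DE.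
  have cd : `|s0 - c| < d by rewrite (le_lt_trans _ sd)// !ler0_norm; lra.
  have := slope c cd; rewrite gt_eqF// => /(_ isT).
  rewrite mulrC ltr_pdivrMr ?subr_gt0// => gc.
  rewrite DE; apply: mulr_ge0; last by rewrite subr_ge0 ltW.
  by rewrite /dD; lra.
Qed.

(** * The normalized p-Laplacian of radial functions *)

Lemma dotvZ (R : realType) (n : nat) (a b : R) (v w : 'rV[R]_n) :
  dotv (a *: v) (b *: w) = a * b * dotv v w.
Proof. by rewrite /dotv mulr_sumr; apply: eq_bigr => i _; rewrite !mxE; ring. Qed.

(** Twice the weight of the second radial derivative in the operator. With s = r^2 that derivative
    of P(s) is 4 s P'' + 2 P', which explains the factor 2. *)
Definition second_order_coef (R : realType) (p : \bar R) : R :=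
  if p is q%:E then 2 * (q - 1) / q else 2.

Section RadialOperators.
Variables (R : realType) (n : nat) (x : 'rV[R]_n) (P P1 P2 : R -> R).
Hypothesis dP : forall s : R, is_derive s 1 P (P1 s).
Hypothesis dP1 : forall s : R, is_derive s 1 P1 (P2 s).

Local Notation phi := (fun y => P (sqdist x y)).

Lemma sqdist_ge0 (y : 'rV[R]_n) : 0 <= sqdist x y.
Proof. by apply: sumr_ge0 => i _; rewrite -expr2 sqr_ge0. Qed.

Lemma sqdist_gt0 (y : 'rV[R]_n) : y != x -> 0 < sqdist x y.
Proof.
move=> yx; rewrite lt_def sqdist_ge0 andbT; apply: contraNneq yx.
rewrite /sqdist /dotv => /eqP.
rewrite psumr_eq0; last by move=> i _; rewrite -expr2 sqr_ge0.
move=> /allP s0; rewrite -subr_eq0; apply/eqP/rowP => i; rewrite [RHS]mxE.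
by have := s0 i; rewrite mem_index_enum -expr2 sqrf_eq0 => /(_ isT)/eqP.
Qed.

Lemma partial_radial i :
  partial i phi = fun y => 2 * P1 (sqdist x y) * (y 0 i - x 0 i).
Proof.
apply/funext => y; rewrite /partial.
have [_ ->] := is_derive_sqdist_comp i (dP (sqdist x y)); by ring.
Qed.

Lemma is_derive_partial_radial i j y :
  is_derive y (delta_mx 0 j) (partial i phi)
    (2 * P1 (sqdist x y) * (i == j)%:R +
     4 * P2 (sqdist x y) * (y 0 i - x 0 i) * (y 0 j - x 0 j)).
Proof.
rewrite partial_radial.
have H : is_derive (sqdist x y) 1 (fun s => 2 * P1 s) (2 * P2 (sqdist x y)).
  by apply: is_derive_eq; rewrite /GRing.scale/=; ring.
by apply: is_derive_eq (is_derive_radial_field i j H) _; ring.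
Qed.

(** Using |y - x|^2 as the variable, instead of |y - x|, gives regularity at the centre [x] as
    well. *)
Lemma C2_radial (Omega : set 'rV[R]_n) : continuous P2 -> C2 Omega phi.
Proof.
move=> cP2 y _.
have cs : {for y, continuous (sqdist x)} by exact: continuous_sqdist.
have cP : continuous P.
  by move=> s; apply: differentiable_continuous; apply/derivable1_diffP; have := dP s.
have cP1 : continuous P1.
  by move=> s; apply: differentiable_continuous; apply/derivable1_diffP; have := dP1 s.
have cc i : {for y, continuous (fun y : 'rV[R]_n => y 0 i - x 0 i)}.
  apply: (@continuousB _ _ _ (fun y : 'rV[R]_n => y 0 i) (cst (x 0 i))).
    exact: coord_continuous.
  exact: cst_continuous.
split=> [|i|i j].
- exact: (continuous_comp cs (cP _)).
- split; first by have := is_derive_sqdist_comp i (dP (sqdist x y)).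
  rewrite partial_radial.
  apply: continuousM (cc i); apply: continuousM; first exact: cst_continuous.
  exact: (continuous_comp cs (cP1 _)).
- split; first by have := is_derive_partial_radial i j y.
  rewrite (_ : partial j _ = fun y => 2 * P1 (sqdist x y) * (i == j)%:R +
     4 * P2 (sqdist x y) * (y 0 i - x 0 i) * (y 0 j - x 0 j)); last first.
    by apply/funext => z; have [_ <-] := is_derive_partial_radial i j z.
  apply: (@continuousD _ _ _ (fun y => 2 * P1 (sqdist x y) * (i == j)%:R)).
    apply: continuousM; last exact: cst_continuous.
    apply: continuousM; first exact: cst_continuous.
    exact: (continuous_comp cs (cP1 _)).
  apply: continuousM (cc j); apply: continuousM (cc i).
  apply: continuousM; first exact: cst_continuous.
  exact: (continuous_comp cs (cP2 _)).
Qed.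

Lemma grad_radial y : grad phi y = (2 * P1 (sqdist x y)) *: (y - x).
Proof. by apply/rowP => i; rewrite !mxE partial_radial. Qed.

Lemma hess_radial y i j : hess phi y i j = 2 * P1 (sqdist x y) * (i == j)%:R +
     4 * P2 (sqdist x y) * (y 0 i - x 0 i) * (y 0 j - x 0 j).
Proof. by rewrite mxE /partial; have [_ ->] := is_derive_partial_radial i j y. Qed.

Lemma enorm_grad_radial y :
  enorm (grad phi y) = Num.sqrt ((2 * P1 (sqdist x y)) ^+ 2 * sqdist x y).
Proof. by rewrite /enorm grad_radial dotvZ expr2. Qed.

(** The gradient is parallel to y - x, an eigenvector of the Hessian with eigenvalue 2 P' + 4 s
    P''. *)
Lemma inf_nlap_radial y : y != x -> P1 (sqdist x y) != 0 ->
  inf_nlap phi y = 4 * sqdist x y * P2 (sqdist x y) + 2 * P1 (sqdist x y).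
Proof.
move=> yx P10; have s0 := sqdist_gt0 yx.
rewrite /inf_nlap /= enorm_grad_radial grad_radial scalerA.
set s := sqdist x y in P10 s0 *.
set t := (X in X *: _).
(* The sign of [t] is that of [P1 s], which is unknown; only its square matters. *)
have t2 : t ^+ 2 * s = 1.
  rewrite /t exprMn exprVn sqr_sqrtr; last by rewrite mulr_ge0 ?(ltW s0) ?sqr_ge0.
  by field; rewrite P10 gt_eqF.
have -> : (t *: (y - x)) *m (hess phi y)^T = (t * (2 * P1 s + 4 * P2 s * s)) *: (y - x).
  apply/rowP => j; rewrite !mxE.
  rewrite (eq_bigr (fun k => t * 2 * P1 s * ((j == k)%:R * (y - x) 0 k) +
     t * 4 * P2 s * (y - x) 0 j * ((y - x) 0 k * (y - x) 0 k))); last first.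
    by move=> k _; rewrite (mxE _ _ k j) hess_radial !mxE -/s; ring.
  rewrite big_split/= -!mulr_sumr (bigD1 j)//= eqxx big1; last first.
    by move=> k /negPf kj; rewrite eq_sym kj mul0r.
  by rewrite -/(dotv (y - x) (y - x)) -/(sqdist x y) -/s mulr1n !mxE; ring.
rewrite dotvZ -/(sqdist x y) -/s.
transitivity ((t ^+ 2 * s) * (4 * s * P2 s + 2 * P1 s)); first by ring.
by rewrite t2 mul1r.
Qed.

(** For finite p the flux is K(s) (y - x), with divergence n K + 2 s K'; the power of the gradient
    left in it cancels against the prefactor. The infinite case is [inf_nlap_radial]. *)
Lemma nlap_radial (p : \bar R) y : (2 <= n)%N -> (n%:R%:E < p)%E ->
  y != x -> P1 (sqdist x y) != 0 ->
  nlap p phi y = second_order_coef p * (2 * sqdist x y * P2 (sqdist x y))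
    + 2 / C_ n p * P1 (sqdist x y).
Proof.
move=> n2 np yx P10; have s0 := sqdist_gt0 yx.
case: p np => [q| |]//= np; last by rewrite inf_nlap_radial//; field.
have q2 : 2 < q.
  by move: np; rewrite lte_fin; apply: le_lt_trans; rewrite ler_nat.
have q0 : 0 < q by lra.
have qn : 0 < q + n%:R - 2.
  have : 2%:R <= n%:R :> R by rewrite ler_nat.
  by lra.
(* [Q] is the squared length of the gradient, so powers of that length are differentiated without a
   square root. *)
pose Q s := (2 * P1 s) ^+ 2 * s.
pose K s := Q s `^ ((q - 2) / 2) * (2 * P1 s).
have powQ z r : enorm (grad phi z) `^ r = Q (sqdist x z) `^ (r / 2).
  rewrite enorm_grad_radial -powR12_sqrt; last by rewrite mulr_ge0 ?sqdist_ge0 ?sqr_ge0.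
  by rewrite -powRrM (mulrC (2^-1)).
set s := sqdist x y in P10 s0 *.
have Qs0 : 0 < Q s by rewrite mulr_gt0// exprn_even_gt0//= mulf_neq0.
have dQ : is_derive s 1 Q (8 * P1 s * P2 s * s + 4 * P1 s ^+ 2).
  by apply: is_derive_eq; rewrite /GRing.scale/=; ring.
have dK : is_derive s 1 K ((q - 2) / 2 * Q s `^ ((q - 2) / 2 - 1) *
    (8 * P1 s * P2 s * s + 4 * P1 s ^+ 2) * (2 * P1 s) + Q s `^ ((q - 2) / 2) * (2 * P2 s)).
  have dQr := is_derive1_comp (is_derive1_powR ((q - 2) / 2) Qs0) dQ.
  rewrite /K; apply: is_derive_eq; rewrite /GRing.scale/=; ring.
have -> : divergence (fun z => enorm (grad phi z) `^ (q - 2) *: grad phi z) y =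
   \sum_(i < n) partial i (fun z => K (sqdist x z) * (z 0 i - x 0 i)) y.
  apply: eq_bigr => i _; congr partial; apply/funext => z.
  by rewrite powQ grad_radial /K !mxE mulrA.
set dKs := (X in is_derive _ _ _ X) in dK.
have -> : \sum_(i < n) partial i (fun z => K (sqdist x z) * (z 0 i - x 0 i)) y =
   n%:R * K s + 2 * dKs * s.
  rewrite (eq_bigr (fun i => K s + 2 * dKs * ((y - x) 0 i * (y - x) 0 i))); last first.
    move=> i _; rewrite /partial; have [_ ->] := is_derive_radial_field i i dK.
    by rewrite eqxx mulr1n !mxE -/s; ring.
  by rewrite big_split/= sumr_const card_ord -mulr_sumr -[K s *+ n]mulr_natl.
rewrite powQ -/s.
have -> : (2 - q) / 2 = - ((q - 2) / 2) by rewrite -mulNr opprB.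
rewrite /dKs /K powRN powRB; last by rewrite (gt_eqF Qs0) implybT.
rewrite powRr1 ?(ltW Qs0)//.
have : Q s `^ ((q - 2) / 2) != 0 by rewrite gt_eqF// powR_gt0.
move: (Q s `^ _) => X X0; rewrite /Q.
by field; rewrite X0 P10 (gt_eqF qn) (gt_eqF q0) (gt_eqF s0).
Qed.

End RadialOperators.

(** * Comparison with the radial barrier *)

(* The subsolution condition, restricted to test functions that are quadratic
   in |z - x|^2. *)
Definition radial_subsolution (R : realType) (n : nat) (c1 c2 : R) (x : 'rV[R]_n)
    (Omega : set 'rV[R]_n) (f u : 'rV[R]_n -> R) : Prop :=
  forall y b c, Omega y -> y != x -> b != 0 ->
  (\forall z \near y, u z - u y <=
    b * (sqdist x z - sqdist x y) + c / 2 * (sqdist x z - sqdist x y) ^+ 2) ->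
  - (c1 * (2 * sqdist x y * c) + c2 * b) <= f y.

Section RadialTest.
Variables (R : realType) (n : nat) (p : \bar R) (Omega : set 'rV[R]_n).
Variables (f u : 'rV[R]_n -> R) (x : 'rV[R]_n).
Hypotheses (n2 : (2 <= n)%N) (np : (n%:R%:E < p)%E).

Let quad (b c s0 s : R) := b * (s - s0) + c / 2 * (s - s0) ^+ 2.
Let quad1 (b c s0 s : R) := b + c * (s - s0).

Let is_derive_quad (b c s0 s : R) : is_derive s 1 (quad b c s0) (quad1 b c s0 s).
Proof.
by rewrite /quad /quad1; apply: is_derive_eq; rewrite /GRing.scale/=; field.
Qed.

Let is_derive_quad1 (b c s0 s : R) : is_derive s 1 (quad1 b c s0) (cst c s).
Proof.
by rewrite /quad1; apply: is_derive_eq; rewrite /GRing.scale/=; ring.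
Qed.

(** The test function is the quadratic polynomial in |z - x|^2. Its gradient at [y] is 2 b (y - x),
    which is nonzero, so the clause for nonvanishing gradients applies. *)
Lemma visc_sub_radial : visc_sub p Omega f u ->
  radial_subsolution (second_order_coef p) (2 / C_ n p) x Omega f u.
Proof.
move=> usub y b c Oy yx b0 touch; set s0 := sqdist x y.
have dq := is_derive_quad b c s0; have dq1 := is_derive_quad1 b c s0.
have q1E : quad1 b c s0 s0 = b by rewrite /quad1 subrr mulr0 addr0.
have qC2 : C2 Omega (fun z => quad b c s0 (sqdist x z)).
  by apply: (C2_radial x dq dq1); exact: cst_continuous.
have [|+ _] := usub y _ Oy qC2.
  near=> z; rewrite /quad subrr expr0n/= !mulr0 addr0 subr0.
  rewrite lerBlDr addrC -lerBlDr.
  near: z; exact: touch.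
rewrite (nlap_radial dq dq1)// -/s0 q1E//; apply.
rewrite (grad_radial x dq) -/s0 q1E scaler_eq0 subr_eq0 (negPf yx) orbF.
by rewrite mulf_eq0 pnatr_eq0.
Unshelve. all: by end_near. Qed.

(** A polynomial touching -u from above is the negative of one touching u from below, and the
    operator is odd where the gradient does not vanish. *)
Lemma visc_super_radial : visc_super p Omega f u ->
  radial_subsolution (second_order_coef p) (2 / C_ n p) x Omega
    (fun y => - f y) (fun y => - u y).
Proof.
move=> usup y b c Oy yx b0 touch; set s0 := sqdist x y.
have dq := is_derive_quad (- b) (- c) s0; have dq1 := is_derive_quad1 (- b) (- c) s0.
have q1E : quad1 (- b) (- c) s0 s0 = - b by rewrite /quad1 subrr mulr0 addr0.
have qC2 : C2 Omega (fun z => quad (- b) (- c) s0 (sqdist x z)).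
  by apply: (C2_radial x dq dq1); exact: cst_continuous.
have [|+ _] := usup y _ Oy qC2.
  near=> z.
  have : - u z - - u y <= b * (sqdist x z - sqdist x y) +
      c / 2 * (sqdist x z - sqdist x y) ^+ 2.
    by near: z; exact: touch.
  by rewrite /quad -/s0; lra.
rewrite (nlap_radial dq dq1)// -/s0 q1E ?oppr_eq0// => H.
suff : f y <= - (second_order_coef p * (2 * s0 * - c) + 2 / C_ n p * - b) by lra.
apply: H; rewrite (grad_radial x dq) -/s0 q1E scaler_eq0 subr_eq0 (negPf yx) orbF.
by rewrite mulf_eq0 oppr_eq0 pnatr_eq0.
Unshelve. all: by end_near. Qed.

End RadialTest.

Lemma sqdist_xx (R : realType) (n : nat) (x : 'rV[R]_n) : sqdist x x = 0.
Proof. by rewrite /sqdist subrr /dotv big1// => i _; rewrite mxE mul0r. Qed.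

(** Away from [x] the power is differentiable. At [x] its limit at zero is available from the right
    only, so the value at [x] is checked separately. *)
Lemma continuous_sqdist_powR (R : realType) (n : nat) (x : 'rV[R]_n) (g : R) :
  0 < g -> continuous (fun z => sqdist x z `^ g).
Proof.
move=> g0 y; have cs : {for y, continuous (sqdist x)} by exact: continuous_sqdist.
have [->|yx] := eqVneq y x; last first.
  have s0 := sqdist_gt0 yx.
  have cp : {for sqdist x y, continuous (fun s : R => s `^ g)}.
    apply: differentiable_continuous; apply/derivable1_diffP.
    by have := is_derive1_powR g s0.
  exact: (continuous_comp cs cp).
apply: (proj2 (@cvgrPdist_lt _ _ _ (nbhs x) _ _ _)) => e e0.
rewrite sqdist_xx powR0 ?gt_eqF//.
have /cvgrPdist_lt/(_ e e0) := powR_cvg0 g0.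
rewrite /at_right => H.
have /= {}H : \forall z \near x, 0 < sqdist x z -> `|0 - sqdist x z `^ g| < e.
  by have := @continuous_sqdist _ _ x x _; rewrite sqdist_xx => /(_ _ H).
near=> z.
have [->|zx] := eqVneq z x; first by rewrite sqdist_xx powR0 ?gt_eqF// subrr normr0.
by have := sqdist_gt0 zx; near: z.
Unshelve. all: by end_near. Qed.

Lemma closure_le (T : topologicalType) (R : realType) (A : set T) (g : T -> R) (M : R) :
  continuous g -> (forall y, A y -> g y <= M) -> forall y, closure A y -> g y <= M.
Proof.
move=> cg gM y; have cl : closed [set y | g y <= M].
  by apply: (preimage_closed _ (@closed_le _ M)) => z _; exact: cg.
move/(closureS (B := [set y | g y <= M]) gM).
by rewrite -((closure_id _).1 cl).
Qed.

Lemma compact_closure (R : realType) (n : nat) (A : set 'rV[R]_n) :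
  bounded_set A -> compact (closure A).
Proof.
move=> [M [Mr AM]]; apply: bounded_closed_compact; last exact: closed_closure.
exists M; split => // N MN y.
apply: closure_le y; first exact: norm_continuous.
exact: AM.
Qed.

(** With G(s) = A s^g - B s, the lower bound on [A] says s G'(s) > 0, so the slope of the test
    polynomial is nonzero; [harm] says that s^g solves the homogeneous equation. *)
Lemma radial_comparison (R : realType) (n : nat) (x : 'rV[R]_n)
    (Omega : set 'rV[R]_n) (f u : 'rV[R]_n -> R) (c1 c2 g A B F : R) :
  open Omega -> bounded_set Omega ->
  {within closure Omega, continuous u} ->
  radial_subsolution c1 c2 x Omega f u ->
  0 < g -> 0 < c1 -> c1 * (2 * (g - 1)) + c2 = 0 ->
  (forall y, Omega y -> f y <= F) -> F < c2 * B ->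
  (forall y, Omega y -> y != x -> B * sqdist x y < A * (g * sqdist x y `^ g)) ->
  (forall z, boundary Omega z -> u z - u x <= A * sqdist x z `^ g - B * sqdist x z) ->
  forall y, closure Omega y -> u y - u x <= A * sqdist x y `^ g - B * sqdist x y.
Proof.
move=> oO bO cu usub g0 c10 harm fF FB grad_gt bd y1 Oy1.
pose w z := A * sqdist x z `^ g - B * sqdist x z.
have cw : continuous w.
  move=> z; apply: (@continuousB _ _ _ (fun z => A * sqdist x z `^ g)).
    apply: continuousM; first exact: cst_continuous.
    exact: continuous_sqdist_powR.
  apply: continuousM; first exact: cst_continuous.
  exact: continuous_sqdist.
have cuw : {within closure Omega, continuous (fun z => u z - w z)}.
  move=> z; apply: (@continuousB _ _ (subspace (closure Omega)) u w); first exact: cu.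
  exact: continuous_subspaceT.
have [|y /set_mem Oy ymax] := compact_EVT_max _ (compact_closure bO) cuw.
  by exists y1.
have {}ymax z : closure Omega z -> u z - w z <= u y - w y.
  by move=> Oz; apply: ymax; exact: mem_set.
(* As [w] vanishes at [x], it suffices that the maximum of u - w does not exceed its value u x
   there. *)
rewrite -/(w y1) lerBlDr -lerBlDl; apply: (le_trans (ymax _ Oy1)).
rewrite leNgt; apply/negP => uwy.
have wx : w x = 0 by rewrite /w sqdist_xx powR0 ?gt_eqF// !mulr0 subr0.
have yx : y != x.
  by apply: contraTneq uwy => ->; rewrite wx subr0 ltxx.
have {}Oy : Omega y.
  rewrite -((interior_id _).1 oO); apply: contrapT => nOy.
  by have := bd y (conj Oy nOy); rewrite -/(w y); lra.
set s0 := sqdist x y; have s00 : 0 < s0 := sqdist_gt0 yx.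
pose G (s : R) := A * s `^ g - B * s.
pose G1 (s : R) := A * (g * s `^ (g - 1)) - B.
pose k := A * (g * ((g - 1) * s0 `^ (g - 1 - 1))).
have dG : \forall s \near s0, is_derive (s : R) 1 G (G1 s).
  near=> s.
  have s_gt0 : 0 < s by near: s; exact: lt_nbhsr.
  have dp := is_derive1_powR g s_gt0.
  by rewrite /G /G1; apply: is_derive_eq; rewrite /GRing.scale/=; ring.
have dG1 : is_derive s0 1 G1 k.
  have dp := is_derive1_powR (g - 1) s00.
  by rewrite /G1 /k; apply: is_derive_eq; rewrite /GRing.scale/=; ring.
(* With this [e] the error [c1 * (2 * s0 * e)] is half of the gap [c2 * B - F]. *)
pose e := (c2 * B - F) / (4 * c1 * s0).
have e0 : 0 < e by rewrite divr_gt0 ?subr_gt0// !mulr_gt0.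
have quad := taylor2_upper dG dG1 e0.
have powE : s0 `^ g = s0 `^ (g - 1) * s0.
  by rewrite powRB ?(gt_eqF s00) ?implybT// powRr1 ?(ltW s00)// divfK ?gt_eqF.
have powE1 : s0 `^ (g - 1) = s0 `^ (g - 1 - 1) * s0.
  by rewrite [in RHS]powRB ?(gt_eqF s00) ?implybT// powRr1 ?(ltW s00)// divfK ?gt_eqF.
have b0 : 0 < G1 s0.
  rewrite -(pmulr_lgt0 _ s00) /G1 mulrBl subr_gt0.
  by have := grad_gt y Oy yx; rewrite -/s0 powE !mulrA.
have touch : \forall z \near y, u z - u y <= G1 s0 * (sqdist x z - s0) +
    (k + e) / 2 * (sqdist x z - s0) ^+ 2.
  have nq : \forall z \near y, G (sqdist x z) <= G s0 + G1 s0 * (sqdist x z - s0) +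
      (k + e) / 2 * (sqdist x z - s0) ^+ 2.
    exact: (continuous_sqdist quad).
  near=> z.
  have Oz : closure Omega z.
    by apply: subset_closure; near: z; exact: open_nbhs_nbhs.
  have uwz := ymax z Oz.
  have : G (sqdist x z) <= G s0 + G1 s0 * (sqdist x z - s0) +
      (k + e) / 2 * (sqdist x z - s0) ^+ 2 by near: z; exact: nq.
  by move: uwz; rewrite /w /G -/s0; lra.
have := usub y (G1 s0) (k + e) Oy yx (lt0r_neq0 b0) touch.
have := fF y Oy; rewrite -/s0.
(* The powers of [s0] carry the factor that [harm] annihilates. What remains would give (c2 B + F) /
   2 <= f y <= F, against F < c2 B. *)
have -> : c1 * (2 * s0 * (k + e)) + c2 * G1 s0 =
  (A * g * s0 `^ (g - 1)) * (c1 * (2 * (g - 1)) + c2) - c2 * B + (c2 * B - F) / 2.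
  rewrite /k /G1 /e powE1; field.
  by rewrite (gt_eqF c10) (gt_eqF s00).
by rewrite harm; lra.
Unshelve. all: by end_near. Qed.

(** * Euclidean distances, diameter and boundary *)

Section Geometry.
Variables (R : realType) (n : nat).
Implicit Types (A : set 'rV[R]_n) (x y z v : 'rV[R]_n).

Lemma enorm_sqdist x y : enorm (y - x) = Num.sqrt (sqdist x y).
Proof. by []. Qed.

Lemma enorm_powR x y (r : R) : enorm (y - x) `^ r = sqdist x y `^ (r / 2).
Proof. by rewrite enorm_sqdist -powR12_sqrt ?sqdist_ge0// -powRrM (mulrC (2^-1)). Qed.

Lemma enorm_gt0 x y : y != x -> 0 < enorm (y - x).
Proof. by move=> yx; rewrite enorm_sqdist sqrtr_gt0 sqdist_gt0. Qed.

Lemma enorm_bound v (M : R) : `|v| < M -> enorm v <= Num.sqrt (n%:R * M ^+ 2).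
Proof.
move=> vM; have coord i : `|v 0 i| < M.
  have : ball (0 : 'rV[R]_n) M v by rewrite mx_norm_ball /ball_/= sub0r normrN.
  by move=> [_ /(_ 0 i)]; rewrite mxE /ball/= sub0r normrN.
apply: ler_wsqrtr; rewrite mulr_natl -[X in M ^+ 2 *+ X]card_ord -sumr_const.
apply: ler_sum => i _; rewrite -expr2 -real_normK ?num_real//.
by rewrite lerXn2r ?nnegrE// ?ltW ?coord// (le_lt_trans _ (coord i)).
Qed.

(** Boundedness makes the set of distances bounded above, so that [sup] is its true supremum and not
    a default value. *)
Lemma enorm_le_ediam A y z : bounded_set A -> A y -> A z -> enorm (y - z) <= ediam A.
Proof.
move=> bA Ay Az; apply: ub_le_sup; last by exists y => //; exists z.
have [M M0 AM] := ex_strict_bound_gt0 bA.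
exists (Num.sqrt (n%:R * (M + M) ^+ 2)) => _ [a Aa [b Ab <-]].
apply: enorm_bound; apply: (le_lt_trans (ler_normB _ _)).
by apply: ltrD; apply: AM.
Qed.

Lemma enorm_le_ediam_closure A x z : bounded_set A -> A x -> closure A z ->
  enorm (z - x) <= ediam A.
Proof.
move=> bA Ax; apply: (closure_le (g := fun z => enorm (z - x))) => [y|y Ay].
  have cs : {for y, continuous (sqdist x)} by exact: continuous_sqdist.
  exact: (continuous_comp cs (@sqrt_continuous _ _)).
exact: enorm_le_ediam.
Qed.

(** A point of the closure with the largest first coordinate is not interior: a small step in that
    direction would stay in [A]. *)
Lemma boundary_nonempty A : (0 < n)%N -> bounded_set A -> A !=set0 -> boundary A !=set0.
Proof.
move=> n0 bA [a Aa]; pose i0 : 'I_n := Ordinal n0.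
have cc : {within closure A, continuous (fun y : 'rV[R]_n => y 0 i0)}.
  by apply: continuous_subspaceT => y; exact: coord_continuous.
have [|y /set_mem Ay ymax] := compact_EVT_max _ (compact_closure bA) cc.
  by exists a; exact: subset_closure.
exists y; split => // /nbhs_ballP[e /= e0 eA].
have e20 : 0 < e / 2 by rewrite divr_gt0.
pose z := y + (e / 2) *: delta_mx 0 i0.
have Az : A z.
  apply: eA; split => // i j; rewrite !mxE /ball/= ltr_distl.
  move: (y i j) => t; case: (i == 0); case: (j == i0) => /=; rewrite ?mulr1 ?mulr0; lra.
have := ymax z (mem_set (subset_closure Az)).
by rewrite /z !mxE !eqxx/=; lra.
Qed.

End Geometry.

(** * The exponent and the constants *)

Section Constants.
Variables (R : realType) (n : nat) (p : \bar R).
Hypotheses (n2 : (2 <= n)%N) (np : (n%:R%:E < p)%E).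

Let n2R : is_true (@Order.le _ R 2 n%:R). Proof. by rewrite ler_nat. Qed.

Lemma alpha_ge0 : 0 <= alpha_ n p.
Proof.
by case: p np => [q| |]//=; rewrite lte_fin => nq; have n2r := n2R; apply: divr_ge0; lra.
Qed.

Lemma alpha_lt1 : alpha_ n p < 1.
Proof.
case: p np => [q| |]//=.
by rewrite lte_fin => nq; have n2r := n2R; rewrite ltr_pdivrMr; lra.
Qed.

Lemma C_gt0 : 0 < C_ n p.
Proof.
case: p np => [q| |]//=.
by rewrite lte_fin => nq; have n2r := n2R; apply: divr_gt0; lra.
Qed.

Lemma second_order_coef_gt0 : 0 < second_order_coef p.
Proof.
case: p np => [q| |]//=.
by rewrite lte_fin => nq; have n2r := n2R; rewrite divr_gt0 ?mulr_gt0 //; lra.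
Qed.

(* |z - x|^(1 - alpha) is p-harmonic away from x. *)
Lemma harmonic_exponent :
  second_order_coef p * (2 * ((1 - alpha_ n p) / 2 - 1)) + 2 / C_ n p = 0.
Proof.
case: p np => [q| |]//=; last by move=> _; field.
rewrite lte_fin => nq; have n2r := n2R; have q0 : q != 0 by apply: lt0r_neq0; lra.
have q1 : q - 1 != 0 by apply: lt0r_neq0; lra.
have qn : q + n%:R - 2 != 0 by apply: lt0r_neq0; lra.
by field; rewrite q0 q1 qn.
Qed.

End Constants.

(** * The estimate from one side and from both *)

(** The comparison needs a source strictly above [f] and a gradient that does not vanish; [eta] pays
    for both strict inequalities and can be taken arbitrarily small. *)
Lemma one_sided_estimate (R : realType) (n : nat) (p : \bar R)
    (Omega : set 'rV[R]_n) (f u : 'rV[R]_n -> R) (x : 'rV[R]_n) (L F eta : R) :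
  (2 <= n)%N -> (n%:R%:E < p)%E ->
  open Omega -> bounded_set Omega -> Omega x ->
  {within closure Omega, continuous u} ->
  radial_subsolution (second_order_coef p) (2 / C_ n p) x Omega f u ->
  (forall y, Omega y -> f y <= F) -> 0 <= F -> 0 <= L -> 0 < eta ->
  (forall z, boundary Omega z -> u z - u x <= L * enorm (z - x) `^ (1 - alpha_ n p)) ->
  forall y, closure Omega y ->
  u y - u x <=
    (L + C_ n p / (1 - alpha_ n p) * ediam Omega `^ (1 + alpha_ n p) * (F + eta) + eta)
    * enorm (y - x) `^ (1 - alpha_ n p).
Proof.
move=> n2 np oO bO Ox cu usub fF F0 L0 eta0 uL y Oy.
have a0 := alpha_ge0 n2 np; have a1 := alpha_lt1 n2 np; have C0 := C_gt0 n2 np.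
set a := alpha_ n p in a0 a1 uL *; set C := C_ n p in C0 usub *.
set D := ediam Omega `^ (1 + a).
(* [g] is the exponent 1 - a halved, as the variable is the squared distance; [B] solves
   [2 / C * B = F + eta]. *)
pose g := (1 - a) / 2; pose B := C * (F + eta) / 2.
have g0 : 0 < g by rewrite /g; lra.
have B0 : 0 < B by rewrite /B divr_gt0// mulr_gt0//; lra.
have D0 : 0 <= D by exact: powR_ge0.
have -> : C / (1 - a) * D * (F + eta) = B * D / g.
  by rewrite /B /g; field; rewrite gt_eqF// subr_gt0.
(* [L] covers the boundary data, [B * D / g] absorbs the quadratic term in both the gradient and the
   boundary condition (g < 1), and [eta] makes the gradient condition strict. *)
set A := L + B * D / g + eta.
(* Here s = s^((1 + a) / 2) s^g, and the first factor is at most diam(Omega)^(1 + a). *)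
have sD z : closure Omega z -> sqdist x z <= D * sqdist x z `^ g.
  move=> Oz; have [->|zx] := eqVneq z x.
    by rewrite sqdist_xx mulr_ge0// powR_ge0.
  have s0 := sqdist_gt0 zx.
  rewrite -[X in X <= _]powRr1 ?(ltW s0)//.
  have -> : 1 = (1 + a) / 2 + g :> R by rewrite /g; field.
  rewrite powRD; last by rewrite (gt_eqF s0) implybT.
  rewrite ler_wpM2r ?powR_ge0// -enorm_powR.
  rewrite ge0_ler_powR ?nnegrE ?sqrtr_ge0//; first by lra.
  - by apply: le_trans (enorm_le_ediam_closure bO Ox Oz); exact: sqrtr_ge0.
  - exact: enorm_le_ediam_closure.
have AgE : A * g = L * g + B * D + eta * g by rewrite /A; field; rewrite gt_eqF.
have AL : B * D <= A - L.
  have : B * D <= B * D / g.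
    by rewrite ler_pdivlMr// ler_piMr// ?mulr_ge0// ?(ltW B0)// /g; lra.
  by rewrite /A; lra.
have comp : u y - u x <= A * sqdist x y `^ g - B * sqdist x y.
  apply: (radial_comparison oO bO cu usub g0 (second_order_coef_gt0 n2 np)
    (harmonic_exponent n2 np) fF) => // [|z Oz zx|z bz].
  - rewrite /B -/C (_ : 2 / C * _ = F + eta) ?ltrDl//.
    by field; rewrite gt_eqF.
  - have sg : 0 < sqdist x z `^ g by rewrite powR_gt0// sqdist_gt0.
    have := sD z (subset_closure Oz); rewrite -(ler_pM2l B0) => H.
    apply: (le_lt_trans H); rewrite (mulrA B) (mulrA A) ltr_pM2r// AgE.
    have := mulr_ge0 L0 (ltW g0); have := mulr_gt0 eta0 g0; lra.
  - apply: le_trans (uL z bz) _; rewrite enorm_powR -/g.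
    have := sD z bz.1; rewrite -(ler_pM2l B0) => H.
    have := ler_wpM2r (powR_ge0 (sqdist x z) g) AL.
    by rewrite -mulrA mulrBl; lra.
apply: (le_trans comp); rewrite enorm_powR -/g gerBl mulr_ge0 ?(ltW B0)//.
exact: sqdist_ge0.
Qed.

Theorem theorem5p1 (R : realType) (n : nat) (p : \bar R)
    (Omega : set 'rV[R]_n) (f u : 'rV[R]_n -> R) :
  (2 <= n)%N -> (n%:R%:E < p)%E ->
  bounded_domain Omega ->
  {within Omega, continuous f} ->
  {within closure Omega, continuous u} ->
  visc_solution p Omega f u ->
  forall x : 'rV[R]_n, Omega x ->
  forall y : 'rV[R]_n, closure Omega y -> y != x ->
  ((`|u y - u x| / enorm (y - x) `^ (1 - alpha_ n p))%:E <=
     ereal_sup [set (`|u z - u x| / enorm (z - x) `^ (1 - alpha_ n p))%:E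
               | z in boundary Omega]
     + (C_ n p / (1 - alpha_ n p) * ediam Omega `^ (1 + alpha_ n p))%:E
       * Linfty_norm Omega f)%E.
Proof.
move=> n2 np [oO _ Oneq bO] cf cu [_ usub usup] x Ox y Oy yx.
have a1 := alpha_lt1 n2 np; have C0 := C_gt0 n2 np.
set S := ereal_sup _; set N := Linfty_norm _ _.
set K := C_ n p / _ * _.
have diam0 : 0 < ediam Omega.
  exact: lt_le_trans (enorm_gt0 yx) (enorm_le_ediam_closure bO Ox Oy).
have K0 : 0 < K by rewrite mulr_gt0 ?powR_gt0// divr_gt0// subr_gt0.
have fN z : Omega z -> (`|f z|%:E <= N)%E by exact: Linfty_norm_ge.
have N0 : (0 <= N)%E by apply: le_trans (fN x Ox).
(* The boundary has to be nonempty: a supremum over it would otherwise be -oo. *)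
have S0 : (0 <= S)%E.
  have [z bz] := boundary_nonempty (ltnW n2) bO Oneq.
  apply: le_trans (ereal_sup_ubound (ex_intro2 _ _ z bz erefl)).
  by rewrite lee_fin divr_ge0 ?powR_ge0.
(* If [N] or [S] is infinite, so is the right side, because [K] is positive and both [S] and [N] are
   nonnegative. *)
have [->|Nfin] := eqVneq N +oo%E.
  by rewrite mulry gtr0_sg// mul1e addey ?leey// gt_eqF// (lt_le_trans _ S0)// ltNy0.
have [->|Sfin] := eqVneq S +oo%E.
  rewrite addye ?leey// gt_eqF// (lt_le_trans ltNy0)//.
  by rewrite mule_ge0// lee_fin ltW.
have Sr : S = (fine S)%:E by rewrite fineK// ge0_fin_numE// ltey.
have Nr : N = (fine N)%:E by rewrite fineK// ge0_fin_numE// ltey.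
set L := fine S in Sr; set F := fine N in Nr.
have L0 : 0 <= L by exact: fine_ge0.
have F0 : 0 <= F by exact: fine_ge0.
rewrite Sr Nr -EFinM -EFinD lee_fin.
have fF z : Omega z -> `|f z| <= F by move=> /fN; rewrite Nr lee_fin.
have uL z : boundary Omega z -> `|u z - u x| <= L * enorm (z - x) `^ (1 - alpha_ n p).
  move=> bz; have zx : z != x.
    by apply: contraPneq bz.2 => ->; rewrite (interior_id _).1.
  rewrite -ler_pdivrMr ?powR_gt0 ?enorm_gt0// -lee_fin -Sr.
  by apply: ereal_sup_ubound; exists z.
have e0 := powR_gt0 (1 - alpha_ n p) (enorm_gt0 yx).
apply/ler_addgt0Pr => e e_gt0.
(* The total loss [K * eta + eta] is then exactly [e]. *)
pose eta := e / (K + 1).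
have K1 : 0 < K + 1 by lra.
have eta0 : 0 < eta by rewrite divr_gt0.
have -> : L + K * F + e = L + K * (F + eta) + eta.
  by rewrite /eta; field; rewrite gt_eqF.
rewrite ler_pdivrMr// ler_norml; apply/andP; split.
(* The lower bound is the upper bound for -u, a radial subsolution with right side -f by the
   supersolution condition on u. *)
- rewrite lerNl (_ : - (u y - u x) = - u y - - u x); last by ring.
  have cNu : {within closure Omega, continuous (fun z => - u z)}.
    by move=> z; apply: (@continuousN _ _ (subspace (closure Omega)) u); exact: cu.
  apply: (one_sided_estimate n2 np oO bO Ox cNu
    (visc_super_radial n2 np usup) _ F0 L0 eta0)
    => // [z /fF|z /uL].
    by rewrite ler_norml lerNl => /andP[].
  by rewrite ler_norml lerNl => /andP[+ _]; lra.
- apply: (one_sided_estimate n2 np oO bO Ox cu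
    (visc_sub_radial n2 np usub) _ F0 L0 eta0)
    => // [z /fF|z /uL].
    by rewrite ler_norml => /andP[].
  by rewrite ler_norml => /andP[].
Qed.
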